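(* Let $R$ be any commutative ring with unity $1 \neq 0$ and let $n\ge 2$ be an integer. Then the multiplicative semigroups $LO_n(1,R)$ and $RO_n(1,R)$ are groups (under matrix multiplication).
   Context: For $k\in R$, $LO_n(k,R)=\{A\in M_n(R) : A^TA=kI_n\}$ and $RO_n(k,R)=\{A\in M_n(R) : AA^T=kI_n\}$, where $M_n(R)$ is the ring of $n\times n$ matrices over $R$ and $I_n$ its identity. *)

(* Defs.v *)
From HB Require Import structures.
From mathcomp Require Import all_boot all_algebra.

Set Implicit Arguments.
Unset Strict Implicit.
Unset Printing Implicit Defensive.

Import GRing.Theory.
Local Open Scope ring_scope.

Definition LO (R : comNzRingType) (n : nat) (k : R) : {pred 'M[R]_n} :=
  [pred A : 'M[R]_n | A^T *m A == k%:M].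

Definition RO (R : comNzRingType) (n : nat) (k : R) : {pred 'M[R]_n} :=
  [pred A : 'M[R]_n | A *m A^T == k%:M].

Arguments LO {R} n k.
Arguments RO {R} n k.

(* [cls] is a [groupType] structure whose carrier is the subset [S] itself.
   The equation makes its product the restriction of [op] to [S], so in
   particular [S] is closed under [op]. The identity and the inverses are those
   of [cls]. *)
Definition is_group_under (T : Type) (op : T -> T -> T) (S : {pred T}) : Prop :=
  exists cls : Group.axioms_ {x : T | x \in S},
    forall x y : Group.Pack cls, sval (x * y)%g = op (sval x) (sval y).

(* Main.v *)
(** The transpose is the only candidate for the inverse. By Cramer's rule a
    one-sided inverse of a square matrix over a commutative ring is two-sided,
    so A^T A = I and A A^T = I are equivalent: each of the two sets is closed
    under transposition, and the transpose inverts on both sides. *)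
From HB Require Import structures.
Require Import Defs.
From mathcomp Require Import all_boot all_algebra.

Local Open Scope ring_scope.

(** Inverses are required on [S] only, since the ambient [op] need be no more than a monoid law, as
    for matrices. *)
Lemma is_group_under_sub (T : choiceType) (op : T -> T -> T) (e : T)
    (inv : T -> T) (S : {pred T}) :
    associative op -> left_id e op -> right_id e op ->
    e \in S -> {in S &, forall x y, op x y \in S} ->
    {in S, forall x, inv x \in S} ->
    {in S, forall x, op (inv x) x = e} -> {in S, forall x, op x (inv x) = e} ->
  is_group_under op S.
Proof.
move=> opA op1x opx1 Se Sop Sinv opVx opxV.
pose U := {x : T | x \in S}.
pose mulU (x y : U) : U := exist _ (op (sval x) (sval y)) (Sop _ _ (svalP x) (svalP y)).
pose invU (x : U) : U := exist _ (inv (sval x)) (Sinv _ (svalP x)).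
pose oneU : U := exist _ e Se.
(* Membership in [S] is boolean, so [sval] is injective and each law on [U] reduces to the one in
   [T]. *)
have mulA : associative mulU by move=> x y z; apply: val_inj; apply: opA.
have mul1 : left_id oneU mulU by move=> x; apply: val_inj; apply: op1x.
have mulx1 : right_id oneU mulU by move=> x; apply: val_inj; apply: opx1.
have mulV : left_inverse oneU invU mulU.
  by move=> x; apply: val_inj; apply: opVx (svalP x).
have mulxV : right_inverse oneU invU mulU.
  by move=> x; apply: val_inj; apply: opxV (svalP x).
pose G : groupType := HB.pack U (isGroup.Build U mulA mul1 mulx1 mulV mulxV).
by exists (Group.class G).
Qed.

Lemma LO1_eq_RO1 (R : comNzRingType) (n : nat) : LO n (1 : R) =i RO n (1 : R).
Proof. by move=> A; rewrite !inE; apply/eqP/eqP; apply: mulmx1C. Qed.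

Lemma trmx_LO (R : comNzRingType) (n : nat) (k : R) (A : 'M[R]_n) :
  (A^T \in LO n k) = (A \in RO n k).
Proof. by rewrite !inE trmxK. Qed.

(** Taking [S] up to [=i] lets one argument serve both sets, which are equal only extensionally. *)
Lemma is_group_under_orthogonal (R : comNzRingType) (n : nat)
    (S : {pred 'M[R]_n}) :
  S =i LO n (1 : R) -> is_group_under mulmx S.
Proof.
move=> SE; apply: (@is_group_under_sub _ _ 1%:M trmx).
- exact: mulmxA.
- exact: mul1mx.
- exact: mulmx1.
- by rewrite SE inE trmx1 mulmx1.
- move=> A B; rewrite !SE !inE => /eqP AA /eqP BB.
  by rewrite trmx_mul -mulmxA (mulmxA A^T) AA mul1mx BB.
- by move=> A; rewrite !SE trmx_LO -LO1_eq_RO1.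
(* The left inverse law is membership in [LO] itself; the right one is membership in [RO]. *)
- by move=> A; rewrite SE => /eqP.
- by move=> A; rewrite SE LO1_eq_RO1 => /eqP.
Qed.

Theorem theorem3p16 (R : comNzRingType) (n : nat) (hn : (2 <= n)%N) :
  is_group_under mulmx (LO n (1 : R)) /\ is_group_under mulmx (RO n (1 : R)).
Proof.
split; apply: is_group_under_orthogonal => // A.
by rewrite LO1_eq_RO1.
Qed.
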